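(* Let $q$ be a prime power and let $m,n$ be integers with $q\geq m\geq 2$ and $n\geq 2m-1$. Let $V$ be an $n$-dimensional vector space over $\mathbb{F}_q$ and let $\mathscr{F}$ be a family of $m$-dimensional subspaces of $V$ that is intersecting and has covering number $\tau(\mathscr{F})=m$. Then $$|\mathscr{F}|\leq {2m-1\brack m}_q,$$ and equality holds if and only if $\mathscr{F}$ is the family of all $m$-dimensional subspaces of $X$ for some $(2m-1)$-dimensional subspace $X$ of $V$.
   Context: For integers $n,m\ge 1$, the Gaussian binomial coefficient is ${n\brack m}_q=\prod_{0\leq i<m}\frac{q^{n-i}-1}{q^{m-i}-1}$; it counts the $m$-dimensional subspaces of an $n$-dimensional space over $\mathbb{F}_q$. Two subspaces $A,B$ intersect if $\dim(A\cap B)\geq 1$. A family of subspaces is intersecting if every two of its members intersect. The covering number $\tau(\mathscr{F})$ of a family $\mathscr{F}$ of subspaces of $V$ is the minimum dimension of a subspace of $V$ that intersects every member of $\mathscr{F}$. *)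

(* Defs.v *)
From HB Require Import structures.
From mathcomp Require Export all_boot all_order all_algebra all_field finmap.

Set Implicit Arguments.
Unset Strict Implicit.
Unset Printing Implicit Defensive.

Import GRing.Theory Num.Theory.
Local Open Scope ring_scope.

(* For n < m the factor at i = n is zero, so the truncated subtraction in the
   exponent [n - i] never affects the value. *)
Definition gauss_binom (q n m : nat) : rat :=
  \prod_(i < m) ((q%:R ^+ (n - i) - 1) / (q%:R ^+ (m - i) - 1)).

Section Families.
Variables (K : fieldType) (V : vectType K).
Implicit Types (A B T : {vspace V}) (F : {fset {vspace V}}).

Definition intersect A B : bool := (1 <= \dim (A :&: B))%N.

Definition intersecting F : Prop := {in F &, forall A B, intersect A B}.

Definition covers T F : Prop := {in F, forall A, intersect T A}.

(* Relational because a family containing the zero subspace has no cover. *)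
Definition covering_number F (t : nat) : Prop :=
  (exists2 T, covers T F & \dim T = t) /\
  (forall T, covers T F -> (t <= \dim T)%N).

End Families.

(* Main.v *)
Require Import Defs.
From mathcomp Require Import all_boot all_order all_algebra all_field finmap.
From mathcomp Require Import zify.

(* Let [k] be the number of points of a k-dimensional space over F_q. As no
   subspace of dimension < m covers F, a subspace S with dim S < m misses some
   A in F, and every member of F through S contains S + <x> for one of the [m]
   points <x> of A; iterating, at most [m]^(m - dim S) members contain S.

   If dim S = m - 1 and more than [m-1] members contain S, then all members A
   missing S span with S one and the same (2m-1)-dimensional space X: a second
   such A', not contained in X = S + A, would give only [m-1] choices, the points
   of A' :&: X. If there is no such S, then |F| <= [m-1][m]^(m-1). If there is
   one and F is not contained in X, the members outside X all meet S, hence number at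
   most [m-1][m]^(m-1), while those inside X all meet some C :&: X with C in F
   of dimension < m, which excludes at least q^(m(m-1)) of the m-subspaces of X.
   Since q >= m gives [m-1][m]^(m-1) < q^(m(m-1)), the bound is then strict;
   the remaining families consist of m-subspaces of X. *)

Set Implicit Arguments.
Unset Strict Implicit.
Unset Printing Implicit Defensive.

(** * Arithmetic of the numbers of points *)

Definition qnum (q k : nat) : nat := \sum_(i < k) q ^ i.

Lemma qnumE q k : (q ^ k).-1 = q.-1 * qnum q k.
Proof. exact: predn_exp. Qed.

Lemma leq_qnum q j k : j <= k -> qnum q j <= qnum q k.
Proof.
move=> /subnKC <-; rewrite /qnum -!(big_mkord predT (expn q)).
by rewrite [leqRHS](@big_cat_nat _ _ _ j) ?leq_addr.
Qed.

(** Multiplying the next case by r^(r+1) reduces it to the induction hypothesis, through r(r+2) <=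
    (r+1)^2. The base case is 4^3 <= 3^4. *)
Lemma expSS_le r : 2 < r -> r.+1 ^ r <= r ^ r.+1.
Proof.
elim: r => // r IHr; rewrite leq_eqVlt => /predU1P[[<-] //|r_gt2].
have {}IHr := IHr r_gt2.
have r_gt0 : 0 < r ^ r.+1 by rewrite expn_gt0; lia.
rewrite -(leq_pmul2r r_gt0) -expnMn.
apply: (@leq_trans ((r.+1 * r.+1) ^ r.+1)); first by rewrite leq_exp2r; nia.
rewrite expnMn -expnD (_ : r.+1 + r.+1 = r.+2 + r); last by lia.
by rewrite expnD leq_mul2l IHr orbT.
Qed.

(* For [q <= 3] the estimate [qnum q k <= q ^ k / (q - 1)] used in general is
   too lossy, and the inequality is checked by computation. *)
Lemma qnum_mul_exp_lt q m : m <= q -> 2 <= m ->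
  qnum q m.-1 * qnum q m ^ m.-1 < q ^ (m * m.-1).
Proof.
move=> m_le_q m_ge2.
have [q_gt3 | q_le3] := ltnP 3 q; last first.
  have [/eqP->|] := boolP (m == 2).
    rewrite !expn1 /qnum !big_ord_recr !big_ord0 /= !expn0 !expn1; nia.
  move=> m_neq2; have [-> ->] : m = 3 /\ q = 3 by lia.
  by rewrite /qnum !big_ord_recr !big_ord0.
have q1_gt0 : 0 < q.-1 ^ m by rewrite expn_gt0; lia.
case: m m_le_q m_ge2 q1_gt0 => // r r_lt_q r_gt0 q1_gt0 /=.
(* With m = r + 1, there is one factor q - 1 for each of the r + 1 point numbers on the left; it
   turns each [k] into q^k - 1. *)
rewrite -(ltn_pmul2l q1_gt0) [X in X * (_ * _)]expnS mulnACA -qnumE -expnMn -qnumE.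
(* Multiplying by (q-1)^(q-1-r), where r + 1 <= q, reduces this to r = q - 1, which is [expSS_le] at
   q - 1. *)
have pow_le : q ^ r <= q.-1 ^ r.+1.
  have p_gt0 : 0 < q.-1 ^ (q.-1 - r) by rewrite expn_gt0; lia.
  rewrite -(leq_pmul2r p_gt0) -expnD (_ : r.+1 + (q.-1 - r) = q.-1.+1); last by lia.
  have q1_gt2 : 2 < q.-1 by lia.
  apply: leq_trans (expSS_le q1_gt2); rewrite prednK; last by lia.
  rewrite [X in _ <= q ^ X](_ : _ = r + (q.-1 - r)); last by lia.
  rewrite expnD leq_mul2l; apply/orP; right.
  by case: (q.-1 - r) => // d; rewrite leq_exp2r ?leq_pred.
apply: (@leq_trans (q ^ r * q ^ (r.+1 * r))); last by rewrite leq_mul2r pow_le orbT.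
have qr_gt0 k : 0 < q ^ k by rewrite expn_gt0; lia.
apply: (@leq_ltn_trans ((q ^ r).-1 * q ^ (r.+1 * r))).
  by rewrite leq_mul2l expnM leq_exp2r // leq_pred orbT.
by rewrite ltn_pmul2r // prednK.
Qed.

(** * Points of subspaces and degrees *)

Section Subspaces.
Variables (K : finFieldType) (V : vectType K).
Implicit Types (A B C E S T U X : {vspace V}) (F G : seq {vspace V}).
Local Notation fV := (finvect_type V).
Local Notation q := #|K|.

Lemma q_gt1 : 1 < q.
Proof. exact: finNzRing_gt1. Qed.

Lemma card_vspace_fin X : #|[pred x : fV | x \in X]| = q ^ \dim X.
Proof.
case: V X => T cT X.
exact: (@card_vspace K (finvect_type (Vector.Pack cT)) cT X).
Qed.

Lemma card_vspaceD X E : (E <= X)%VS ->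
  #|[pred x : fV | (x \in X) && (x \notin E)]| = q ^ \dim X - q ^ \dim E.
Proof.
move=> /subvP sEX; rewrite -!card_vspace_fin.
rewrite -(cardID [pred x : fV | x \in E] [pred x : fV | x \in X]).
rewrite [X in _ = X + _ - _](eq_card (B := [pred x : fV | x \in E])) => [|x]; last first.
  by rewrite !inE /=; apply/andP/idP => [[]|xE] //; rewrite sEX.
by rewrite addKn; apply: eq_card => x; rewrite !inE andbC.
Qed.

(* Double counting of the pairs [(x, B)] with [x != 0] in [T :&: B]. *)
Lemma branching G T c :
  {in G, forall B, intersect T B} ->
  (forall x, x \in T -> x != 0%R -> count (fun B => x \in B) G <= c) ->
  size G <= qnum q (\dim T) * c.
Proof.
move=> meetT ltc; have q1 : 0 < q.-1 by have := q_gt1; lia.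
pose nz X := [pred x : fV | (x \in X) && (x \notin (0%VS : {vspace V}))].
have nzE X : #|nz X| = q.-1 * qnum q (\dim X).
  by rewrite /nz card_vspaceD ?sub0v // dimv0 expn0 subn1 qnumE.
(* The factor q - 1 replaces points by nonzero vectors. *)
rewrite -(leq_pmul2l q1) mulnA -nzE -sum_nat_const.
apply: (@leq_trans (\sum_(x in nz T) count (fun B => (x : V) \in B) G)); last first.
  by apply: leq_sum => x; rewrite inE memv0 => /andP[]; apply: ltc.
under eq_bigr do rewrite -sum1_count big_mkcond.
rewrite exchange_big /= mulnC -sum1_size big_distrl /=.
rewrite big_seq [leqRHS]big_seq; apply: leq_sum => B /meetT; rewrite /intersect mul1n => dTB.
rewrite -big_mkcondr sum1_card.
rewrite (eq_card (B := nz (T :&: B)%VS)) => [|x].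
  by rewrite nzE leq_pmulr //; apply: leq_trans (leq_qnum q dTB); rewrite /qnum big_ord1.
by rewrite !inE /= [_ \in (T :&: B)%VS](memv_cap (x : V)) andbAC unfold_in.
Qed.

Lemma dimv_add_line S (x : V) : x \notin S -> \dim (S + <[x]>) = (\dim S).+1.
Proof.
move=> xS; have x0 : x != 0%R by apply: contraNneq xS => ->; rewrite mem0v.
rewrite dimv_disjoint_sum ?dim_vline ?x0 ?addn1 //.
apply/eqP; rewrite -subv0; apply/subvP => y; rewrite memv_cap => /andP[yS /vlineP[k def_y]].
move: yS; rewrite {}def_y memv0; have [-> |k0] := eqVneq k 0%R; first by rewrite GRing.scale0r eqxx.
by rewrite GRing.rpredZeq (negPf k0) (negPf xS).
Qed.

Definition degree F S := count (fun B => (S <= B)%VS) F.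

Lemma degree_add_line F S (x : V) :
  degree F (S + <[x]>) = count (fun B => x \in B) (filter (fun B => (S <= B)%VS) F).
Proof. by rewrite count_filter; apply: eq_count => B; rewrite /= subv_add andbC memvE. Qed.

(** A member through S that contains a nonzero x of T contains S + <x>, so bounds one dimension
    higher descend to S. *)
Lemma degree_branching F S T c :
  {in F, forall B, (S <= B)%VS -> intersect T B} ->
  (forall x, x \in T -> x != 0%R -> degree F (S + <[x]>) <= c) ->
  degree F S <= qnum q (\dim T) * c.
Proof.
move=> meetT lec; rewrite /degree -size_filter; apply: branching => [B|x xT x0].
  by rewrite mem_filter => /andP[sSB FB]; apply: meetT.
by rewrite -degree_add_line; apply: lec.
Qed.

Lemma intersect_capv0 A B : ~~ intersect A B = ((A :&: B)%VS == 0%VS).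
Proof. by rewrite /intersect lt0n negbK dimv_eq0. Qed.

Lemma disjoint_notin A B (x : V) : ~~ intersect A B -> x \in B -> x != 0%R -> x \notin A.
Proof.
rewrite intersect_capv0 => /eqP AB0 xB; apply: contraNN => xA.
by rewrite -memv0 -AB0 memv_cap xA.
Qed.

(** * Counting frames and subspaces *)

Definition vectors_outside X E : seq V :=
  enum [pred x : fV | (x \in X) && (x \notin E)].

Lemma mem_vectors_outside X E (x : V) :
  (x \in vectors_outside X E) = (x \in X) && (x \notin E).
Proof. exact: (@mem_enum fV). Qed.

Lemma uniq_vectors_outside X E : uniq (vectors_outside X E).
Proof. exact: (@enum_uniq fV). Qed.

Lemma size_vectors_outside X E : (E <= X)%VS ->
  size (vectors_outside X E) = q ^ \dim X - q ^ \dim E.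
Proof. by move=> /card_vspaceD <-; rewrite cardE. Qed.

(** These are the k-frames of X that are independent modulo E: each vector avoids the span of E and
    its predecessors, so their number is a plain product. *)
Fixpoint indep_seqs k E X : seq (seq V) :=
  if k is k'.+1 then
    [seq x :: t | x <- vectors_outside X E, t <- indep_seqs k' (E + <[x]>)%VS X]
  else [:: [::]].

Lemma uniq_indep_seqs k E X : uniq (indep_seqs k E X).
Proof.
elim: k E => //= k IHk E; apply: allpairs_uniq_dep => //.
  exact: uniq_vectors_outside.
by move=> [x s] [y t] _ _ /= [-> ->].
Qed.

Lemma size_indep_seqs k E X : (E <= X)%VS ->
  size (indep_seqs k E X) = \prod_(i < k) (q ^ \dim X - q ^ (\dim E + i)).
Proof.
elim: k E => [|k IHk] E sEX; first by rewrite big_ord0.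
rewrite /= size_allpairs_dep big_ord_recl addn0 -size_vectors_outside //.
set c := \prod_(_ < k) _; rewrite sumnE big_map.
rewrite (eq_big_seq (fun _ => c)) => [|x]; last first.
  rewrite mem_vectors_outside => /andP[xX xE]; rewrite IHk ?subv_add ?sEX //.
  by apply: eq_bigr => i _; rewrite dimv_add_line //= addnS.
by rewrite big_const_seq count_predT iter_addn_0 mulnC.
Qed.

Lemma mem_indep_seqs k E X t : (E <= X)%VS ->
  (t \in indep_seqs k E X) =
  [&& size t == k, (<<t>> <= X)%VS & \dim (E + <<t>>) == \dim E + k].
Proof.
elim: k E t => [|k IHk] E t sEX.
  rewrite inE addn0; case: t => [|x t] //=.
  by rewrite span_nil sub0v addv0 !eqxx.
apply/idP/idP => [/(@allpairsPdep V (fun=> seq V))[x [s [xXE sI ->]]]|].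
  move: xXE sI; rewrite mem_vectors_outside => /andP[xX xE].
  rewrite IHk ?subv_add ?sEX // dimv_add_line // => /and3P[/eqP/= -> sX /eqP dE].
  by rewrite span_cons subv_add -memvE xX sX eqxx addvA dE addnS /=.
case: t => [|x t] /and3P[//= /eqP[size_t]].
rewrite span_cons subv_add -memvE addvA => /andP[xX tX] /eqP dE.
have dim_t : \dim <<t>> <= k by rewrite -size_t dim_span.
have xE : x \notin E.
  apply/negP => xE; have := dimv_add_leqif E <<t>>.
  move: dE; rewrite (_ : E + <[x]> = E)%VS; last by apply/addv_idPl; rewrite -memvE.
  by move=> -> [] + _; lia.
apply/(@allpairsPdep V (fun=> seq V)); exists x, t; rewrite mem_vectors_outside xX xE; split=> //.
by rewrite IHk ?subv_add ?sEX // size_t tX dE dimv_add_line // addSnnS !eqxx.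
Qed.

(** These are the k-subspaces of X meeting E trivially, true complements only if dim E + k = dim X.
    E = 0 gives all k-subspaces of X. *)
Definition complements k E X : seq {vspace V} :=
  undup [seq <<t>>%VS | t <- indep_seqs k E X].

Lemma mem_complements k E X U : (E <= X)%VS ->
  (U \in complements k E X) = [&& \dim U == k, (U <= X)%VS & ~~ intersect E U].
Proof.
move=> sEX; rewrite mem_undup; apply/mapP/and3P => [[t]|[/eqP dU sUX dis]].
  rewrite mem_indep_seqs // => /and3P[/eqP st tX /eqP dEt] ->.
  have dt : \dim <<t>> <= k by rewrite -st dim_span.
  have := dimv_sum_cap E <<t>>; rewrite /intersect.
  by split=> //; lia.
exists (tval (vbasis U)); last by rewrite (span_basis (vbasisP U)).
rewrite mem_indep_seqs // (span_basis (vbasisP U)) size_tuple dU sUX !eqxx /=.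
by move: dis; rewrite intersect_capv0 => /eqP/dimv_disjoint_sum ->; rewrite dU.
Qed.

Lemma size_complements_mul k E X : (E <= X)%VS ->
  size (complements k E X) * \prod_(i < k) (q ^ k - q ^ i) =
  \prod_(i < k) (q ^ \dim X - q ^ (\dim E + i)).
Proof.
move=> sEX; rewrite -size_indep_seqs //.
rewrite -sum1_size big_distrl /=.
under eq_bigr do rewrite mul1n.
rewrite -(size_map (fun t => <<t>>%VS) (indep_seqs k E X)) -sum1_size.
rewrite -[RHS]big_undup_iterop_count /= -/(complements k E X).
rewrite big_seq [RHS]big_seq; apply: eq_bigr => U UC; rewrite Monoid.iteropE iter_addn_0 mul1n count_map.
move: UC; rewrite mem_complements // => /and3P[/eqP dU sUX].
rewrite intersect_capv0 => /eqP EU0.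
(* As U misses E, the frames modulo E that span U are exactly the ordered bases of U. *)
transitivity (size (indep_seqs k 0%VS U)).
  by rewrite size_indep_seqs ?sub0v // dimv0 dU.
rewrite -size_filter; apply/perm_size/uniq_perm; rewrite ?filter_uniq ?uniq_indep_seqs //.
move=> t; rewrite mem_filter !mem_indep_seqs ?sub0v //= dimv0 !add0v.
have [_|_] /= := boolP (size t == k); last by rewrite andbF.
apply/andP/and3P => [[tU /eqP dt]|[/eqP-> _ _]]; last by rewrite subvv dU.
have -> : <<t>>%VS = U by apply/eqP; rewrite -(dimv_leqif_eq tU) dt dU.
by rewrite eqxx sUX dimv_disjoint_sum // dU.
Qed.

Lemma prod_frame_gt0 k : 0 < \prod_(i < k) (q ^ k - q ^ i).
Proof.
by apply: prodn_gt0 => i; rewrite subn_gt0 ltn_exp2l ?ltn_ord ?q_gt1.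
Qed.

Lemma size_complements_dim k E E' X X' : (E <= X)%VS -> (E' <= X')%VS ->
  \dim E = \dim E' -> \dim X = \dim X' ->
  size (complements k E X) = size (complements k E' X').
Proof.
move=> sEX sEX' dE dX; apply/eqP; rewrite -(eqn_pmul2r (prod_frame_gt0 k)).
by rewrite !size_complements_mul // dE dX.
Qed.

(** Compared factor by factor: q^(m-1) (q^m - q^i) = q^(2m-1) - q^(m-1+i), and dim E <= m - 1. *)
Lemma size_complements_ge m E X : 0 < m -> (E <= X)%VS ->
  \dim E < m -> \dim X = 2 * m - 1 ->
  q ^ (m * m.-1) <= size (complements m E X).
Proof.
move=> m_gt0 sEX dE dX; rewrite -(leq_pmul2r (prod_frame_gt0 m)).
have -> : q ^ (m * m.-1) = \prod_(i < m) q ^ m.-1.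
  by rewrite prod_nat_const card_ord -expnM mulnC.
rewrite size_complements_mul // -big_split /=.
apply: leq_prod => i _; rewrite mulnBr -!expnD dX.
rewrite (_ : m.-1 + m = 2 * m - 1); last by lia.
by rewrite leq_sub2l // leq_pexp2l ?(ltnW q_gt1) // leq_add2r -ltnS prednK.
Qed.

(** Dividing the number of k-frames of X by that of a k-space, the powers q^i cancel in each
    factor. *)
Lemma gauss_binomE k n X : \dim X = n -> k <= n ->
  gauss_binom q n k = (size (complements k 0%VS X))%:R%R.
Proof.
move=> dX le_kn; have q1 := q_gt1.
have /(congr1 (fun x => x%:R%R : rat)) := size_complements_mul k (sub0v X).
have natrBX a j : j <= a ->
    (q ^ a - q ^ j)%:R%R = (q%:R ^+ j * (q%:R ^+ (a - j) - 1))%R :> rat.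
  move=> le_ja; rewrite GRing.natrB; last by rewrite leq_pexp2l; lia.
  by rewrite !GRing.natrX GRing.mulrBr GRing.mulr1 -GRing.exprD subnKC.
have nz j : j != 0 -> (q%:R ^+ j - 1 != 0 :> rat)%R.
  move=> j0; rewrite GRing.subr_eq0 -GRing.natrX (Num.Theory.eqr_nat _ _ 1).
  by rewrite -(expn0 q) eqn_exp2l.
rewrite GRing.natrM !GRing.natr_prod dX dimv0 /gauss_binom => H.
have nzP : (\prod_(i < k) (q ^ k - q ^ i)%:R != 0 :> rat)%R.
  by rewrite -GRing.natr_prod Num.Theory.pnatr_eq0 -lt0n prod_frame_gt0.
apply: (GRing.mulIf nzP); rewrite H -big_split /=; apply: eq_bigr => i _.
have lt_ik := ltn_ord i; rewrite !natrBX; [|lia|lia].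
by rewrite GRing.mulrCA GRing.divfK // nz //; lia.
Qed.

Lemma exists_subspace k : k <= \dim {:V} -> exists X : {vspace V}, \dim X = k.
Proof.
move=> le_k; have : 0 < size (complements k 0%VS {:V}%VS).
  rewrite -(ltn_pmul2r (prod_frame_gt0 k)) mul0n size_complements_mul ?sub0v //.
  apply: prodn_gt0 => i; rewrite subn_gt0 dimv0 ltn_exp2l ?q_gt1 //.
  exact: leq_trans (ltn_ord i) le_k.
case Dc: complements => [|X c] // _; exists X; apply/eqP.
by have := mem_head X c; rewrite -Dc mem_complements ?sub0v // => /and3P[].
Qed.

(** * Intersecting families that no subspace of dimension < m covers *)

Lemma degree_dim_le1 F S m : uniq F -> {in F, forall A, \dim A = m} ->
  \dim S = m -> degree F S <= 1.
Proof.
move=> uniqF dimF dS; apply: (@leq_trans (count_mem S F)); last first.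
  by rewrite count_uniq_mem ?leq_b1.
rewrite /degree -!size_filter; apply: uniq_leq_size; rewrite ?filter_uniq //.
move=> B; rewrite !mem_filter => /andP[sSB FB]; rewrite FB /= andbT eq_sym.
by rewrite -(dimv_leqif_eq sSB) dS dimF.
Qed.

Section Family.
Variables (m : nat) (F : seq {vspace V}).
Hypotheses (m_ge2 : 2 <= m) (m_le_q : m <= q) (uniqF : uniq F).
Hypothesis dimF : {in F, forall A, \dim A = m}.
Hypothesis intF : {in F &, forall A B, intersect A B}.
Hypothesis tauF : forall T, \dim T < m -> exists2 A, A \in F & ~~ intersect T A.

(** The level k at which branching stops is left free: k = m with c = 1 gives [degree_le_exp], and k
    = m - 1 with c = [m-1] handles the case where no (m-1)-space has large degree. *)
Lemma degree_le k c S : k <= m ->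
  (forall T, \dim T = k -> degree F T <= c) ->
  \dim S <= k -> degree F S <= qnum q m ^ (k - \dim S) * c.
Proof.
move=> le_km degT; move Dd: (k - \dim S) => d; elim: d S Dd => [|d IHd] S Dd dS.
  by rewrite mul1n degT //; lia.
have [|A FA SA] := tauF (T := S); first lia.
rewrite expnS -mulnA -{1}(dimF FA); apply: degree_branching => [B FB _|x xA x0].
  exact: intF.
have xS := disjoint_notin SA xA x0.
by apply: IHd; rewrite dimv_add_line //; lia.
Qed.

Lemma degree_le_exp S : \dim S <= m -> degree F S <= qnum q m ^ (m - \dim S).
Proof.
move=> dS; rewrite -[leqRHS]muln1; apply: degree_le dS => // T.
exact: degree_dim_le1.
Qed.

Lemma sub_span_of_rich S A A' : \dim S = m.-1 -> qnum q m.-1 < degree F S ->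
  A \in F -> ~~ intersect S A -> A' \in F -> ~~ intersect S A' ->
  (A' <= S + A)%VS.
Proof.
move=> dS rich FA dSA FA' dSA'; apply: contraLR rich => A'X; rewrite -leqNgt.
set X := (S + A)%VS in A'X *.
apply: (@leq_trans (qnum q (\dim (A' :&: X)) * 1)).
  (* The constant 1: a point of A' lies outside S and spans with it an m-space, which is at most one
     member. *)
  apply: degree_branching => [B FB sSB|x]; last first.
    rewrite memv_cap => /andP[xA' _] x0; apply: degree_dim_le1 dimF _ => //.
    by rewrite dimv_add_line ?dS ?(disjoint_notin dSA') //; lia.
  (* A :&: B is nonzero and misses S, a hyperplane of B; hence B = S + (A :&: B). *)
  have BX : (B <= X)%VS.
    have AB := intF FA FB; rewrite intersect_capv0 in dSA.
    have dSAB : \dim (S + (A :&: B)) = \dim S + \dim (A :&: B).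
      apply: dimv_disjoint_sum; apply/eqP.
      by rewrite capvA (eqP dSA) cap0v.
    have sB : (S + (A :&: B) <= B)%VS by rewrite subv_add sSB capvSr.
    have /eqP <- : (S + (A :&: B))%VS == B.
      rewrite -(dimv_leqif_eq sB) eqn_leq dimvS //= dSAB dS (dimF FB).
      by move: AB; rewrite /intersect; lia.
    by rewrite addvS // capvSl.
  by rewrite /intersect -capvA (capv_idPr BX); apply: intF.
rewrite muln1 leq_qnum // -ltnS prednK ?(ltnW m_ge2) //.
rewrite -[ltnRHS](dimF FA') (ltn_leqif (dimv_leqif_eq (capvSl _ _))).
by apply: contraNneq A'X => <-; apply: capvSr.
Qed.

(** The second alternative is strict, so that equality in the bound forces the first. *)
Lemma in_subspace_or_small :
  (exists2 X, \dim X = 2 * m - 1 & {in F, forall A, (A <= X)%VS}) \/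
  (forall X, \dim X = 2 * m - 1 -> size F < size (complements m 0%VS X)).
Proof.
have m_gt0 : 0 < m by lia.
have sizeF : size F = degree F 0%VS.
  by rewrite -count_predT; apply: eq_count => B; rewrite sub0v.
(* Running over the finite list of all (m-1)-subspaces makes the case distinction decidable. *)
have [poor | /allPn[S]] := boolP
    (all (fun S => degree F S <= qnum q m.-1) (complements m.-1 0%VS {:V}%VS)).
  right=> X dX; apply: leq_trans (size_complements_ge m_gt0 (sub0v X) _ dX); last first.
    by rewrite dimv0.
  apply: leq_ltn_trans (qnum_mul_exp_lt m_le_q m_ge2).
  have degT T : \dim T = m.-1 -> degree F T <= qnum q m.-1.
    move=> dT; move/allP/(_ T): poor; apply; rewrite mem_complements ?sub0v // dT eqxx subvf.
    by rewrite intersect_capv0 cap0v eqxx.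
  have := degree_le (leq_pred m) degT (S := 0%VS).
  by rewrite sizeF mulnC dimv0 subn0; apply.
rewrite mem_complements ?sub0v // -ltnNge => /and3P[/eqP dS _ _] rich.
have [|A FA SA] := tauF (T := S); first by lia.
have sAX A' := @sub_span_of_rich S A A' dS rich FA SA.
set X := (S + A)%VS in sAX.
have dX : \dim X = 2 * m - 1.
  rewrite dimv_disjoint_sum; last by apply/eqP; rewrite -intersect_capv0.
  by rewrite dS (dimF FA); lia.
have [/allP FX | /allPn[C FC CX]] := boolP (all (fun B => (B <= X)%VS) F).
  by left; exists X.
right=> X' dX'; rewrite (size_complements_dim m (sub0v X') (sub0v X)) ?dX' //.
rewrite -(count_predC (fun B => (B <= X)%VS) F).
have dE : \dim (C :&: X) < m.
  rewrite -(dimF FC) (ltn_leqif (dimv_leqif_eq (capvSl _ _))).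
  by apply: contraNneq CX => <-; apply: capvSr.
(* Members inside X meet C within C :&: X, so they are disjoint from the m-subspaces of X that miss
   C :&: X. *)
have inside : count (fun B => (B <= X)%VS) F + size (complements m (C :&: X) X)
    <= size (complements m 0%VS X).
  rewrite -size_filter -size_cat; apply: uniq_leq_size => [|B].
    rewrite cat_uniq filter_uniq ?undup_uniq // andbT.
    apply/hasPn => B; rewrite mem_complements ?capvSr // => /and3P[_ BX].
    apply: contraNN; rewrite mem_filter => /andP[_ FB].
    by rewrite /intersect -capvA (capv_idPr BX); apply: intF.
  rewrite mem_complements ?sub0v // intersect_capv0 cap0v eqxx andbT.
  rewrite mem_cat mem_filter mem_complements ?capvSr //.
  by case/orP => [/andP[-> /dimF ->]|/and3P[-> ->]]; rewrite ?eqxx.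
(* By [sAX], a member not in X meets S, so it passes through one of the [m-1] points of S, each of
   degree at most [m]^(m-1). *)
have outside : count (predC (fun B => (B <= X)%VS)) F
    <= qnum q m.-1 * qnum q m ^ m.-1.
  rewrite -size_filter -[X in qnum q X * _]dS; apply: branching => [B|x xS x0].
    rewrite mem_filter => /andP[/= BX FB].
    by apply: contraNT BX => /sAX; apply.
  have d1 : \dim <[x]> = 1 by rewrite dim_vline x0.
  have := @degree_le_exp <[x]>%VS; rewrite d1 subn1 => /(_ m_gt0); apply: leq_trans.
  rewrite count_filter /degree; apply: sub_count => B /andP[/=].
  by rewrite memvE.
have ge := size_complements_ge m_gt0 (capvSr C X) dE dX.
have lt := qnum_mul_exp_lt m_le_q m_ge2.
apply: leq_ltn_trans (leq_add (leqnn _) outside) _.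
apply: leq_trans inside; rewrite ltn_add2l.
exact: leq_trans lt ge.
Qed.
End Family.

End Subspaces.

(** * The bound and the case of equality *)

Theorem theorem1p2 (q m n : nat) (K : finFieldType) (V : vectType K)
    (F : {fset {vspace V}})
    (card_K : #|K| = q) (m_le_q : (m <= q)%N) (m_ge2 : (2 <= m)%N)
    (n_ge : (2 * m - 1 <= n)%N) (dim_V : \dim {:V} = n)
    (dim_F : forall A : {vspace V}, A \in F -> \dim A = m)
    (int_F : intersecting F) (tau_F : covering_number F m) :
  (((#|` F|)%:R : rat) <= gauss_binom q (2 * m - 1) m)%R /\
  (((#|` F|)%:R : rat) = gauss_binom q (2 * m - 1) m <->
   exists X : {vspace V}, \dim X = (2 * m - 1)%N /\
     forall A : {vspace V}, A \in F <-> \dim A = m /\ (A <= X)%VS).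
Proof.
subst q.
have gaussE (X : {vspace V}) : \dim X = 2 * m - 1 ->
    gauss_binom #|K| (2 * m - 1) m = (size (complements m 0%VS X))%:R%R.
  by move=> dX; apply: gauss_binomE; rewrite ?dX //; lia.
have memX (X A : {vspace V}) : (A \in complements m 0%VS X) <-> \dim A = m /\ (A <= X)%VS.
  rewrite mem_complements ?sub0v // intersect_capv0 cap0v eqxx andbT.
  by split=> [/andP[/eqP]|[-> ->]]; rewrite ?eqxx.
have full (X : {vspace V}) : (forall A, A \in F <-> \dim A = m /\ (A <= X)%VS) ->
    #|` F| = size (complements m 0%VS X).
  move=> FX; apply/perm_size/uniq_perm; rewrite ?fset_uniq ?undup_uniq // => A.
  by apply/idP/idP => [/FX/memX|/memX/FX].
have tauF (T : {vspace V}) : \dim T < m -> exists2 A, A \in enum_fset F & ~~ intersect T A.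
  move=> dT; apply/allPn; apply: contraL dT => /allP covT.
  by rewrite -leqNgt; apply: (tau_F.2).
have [[X dX sFX]|small] := in_subspace_or_small m_ge2 m_le_q (fset_uniq F) dim_F int_F tauF.
  have subF : {subset enum_fset F <= complements m 0%VS X}.
    by move=> A FA; apply/memX; split; [apply: dim_F | apply: sFX].
  rewrite (gaussE X dX) Num.Theory.ler_nat; split.
    exact: uniq_leq_size (fset_uniq F) subF.
  split=> [/eqP|[X' [dX' FX']]]; last first.
    (* X' need not be given as X, but the count depends on the dimension alone. *)
    by rewrite (full X' FX'); congr (_%:R)%R; apply: size_complements_dim; rewrite ?sub0v ?dX'.
  rewrite Num.Theory.eqr_nat => /eqP eqs; exists X; split=> // A; rewrite -memX.
  have [|_ eqF] := uniq_min_size (fset_uniq F) subF; first by rewrite -eqs.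
  by rewrite -eqF.
(* The bound n >= 2m - 1 provides a space to compare with; the inequality is then strict and both
   sides of the equivalence fail. *)
have [X dX] : exists X : {vspace V}, \dim X = 2 * m - 1.
  by apply: exists_subspace; rewrite dim_V.
rewrite (gaussE X dX) Num.Theory.ler_nat; split; first exact/ltnW/small.
split=> [/eqP|[X' [dX' FX']]].
  by rewrite Num.Theory.eqr_nat => /eqP eqs; have := small X dX; rewrite -eqs ltnn.
by have := small X' dX'; rewrite (full X' FX') ltnn.
Qed.
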